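(* Let $T$ be a hypercyclic continuous linear operator on a complex topological vector space $X$, let $p\geq 1$ and let $g_1,\dots,g_p$ be elements of an abelian compact topological group $G$. Let also $\mathbf d=(d_1,\dots,d_p)\in\mathbb N^p$ and put $\mathbf g=(g_1,\dots,g_p)$. Then for every $u\in HC(T)$ and every $v\in X$, $1_G\in F_{u,v}^{\mathbf g,\mathbf d}$.
   Context: $\mathbb N$ denotes the positive integers and $1_G$ the identity of $G$. $HC(T)$ is the set of hypercyclic vectors for $T$, i.e. the vectors $x\in X$ such that $\{T^n x;\ n\geq 0\}$ is dense in $X$; $T$ is hypercyclic if $HC(T)\neq\emptyset$. For $\mathbf g=(g_1,\dots,g_p)\in G^p$, $\mathbf d=(d_1,\dots,d_p)\in\mathbb N^p$ and $u,v\in X$, define $$N_u^{\mathbf g,\mathbf d}=\overline{\left\{(T^n u,\ g_1^{n^{d_1}},g_1^{n^{d_1-1}},\dots,g_1^{n},\ g_2^{n^{d_2}},\dots,g_2^{n},\ \dots,\ g_p^{n^{d_p}},\dots,g_p^{n});\ n\geq 1\right\}}\subset X\times G^{d_1+\dots+d_p},$$ where, for each $j$, the exponents of $g_j$ are successively $n^{d_j},n^{d_j-1},\dots,n$, and $$F_{u,v}^{\mathbf g,\mathbf d}=\left\{h\in G;\ (v,h,1_G,\dots,1_G)\in N_u^{\mathbf g,\mathbf d}\right\}.$$ *)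

(* Defs.v *)
From mathcomp Require Import all_boot all_order all_algebra.
From mathcomp Require Import all_classical all_reals all_analysis.
From mathcomp Require Import complex.

Set Implicit Arguments.
Unset Strict Implicit.
Unset Printing Implicit Defensive.

Import Order.TTheory GRing.Theory Num.Theory.

Local Open Scope classical_set_scope.
Local Open Scope ring_scope.

(** Abelian topological groups are [topologicalZmodType]s and are therefore
    written additively: [0] stands for $1_G$ and [g *+ m] for $g^m$. *)

Definition HC (X : topologicalType) (T : X -> X) : set X :=
  [set x | dense [set iter n T x | n in [set: nat]]].

Definition hypercyclic (X : topologicalType) (T : X -> X) : Prop :=
  HC T !=set0.

Section PolynomialPhases.
Variables (X : topologicalType) (G : topologicalZmodType) (T : X -> X).
Variables (p : nat) (g : 'I_p -> G) (d : 'I_p -> nat).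

(** Column indices start at 0, so the exponents in block [j] are
    $n^{d_j}, n^{d_j-1}, \dots, n^1$. *)
Definition phases (n : nat) : 'rV[G]_((\sum_j d j)%N) :=
  \mxrow_j \row_(k < d j) (g j *+ (n ^ (d j - k))%N).

Definition Nset (u : X) : set (X * 'rV[G]_((\sum_j d j)%N)) :=
  closure [set (iter n T u, phases n) | n in [set n | (1 <= n)%N]].

Definition Fset (u v : X) : set G :=
  [set h | Nset u (v, \row_(i < (\sum_j d j)%N) if val i == 0%N then h else 0)].

End PolynomialPhases.

(* Main.v *)
Require Import Defs.
From mathcomp Require Import all_boot all_order all_algebra.
From mathcomp Require Import all_classical all_reals all_analysis.
From mathcomp Require Import complex ring lra zify.

Set Implicit Arguments.
Unset Strict Implicit.
Unset Printing Implicit Defensive.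

Import Order.TTheory GRing.Theory Num.Theory.
Import numFieldNormedType.Exports.

Local Open Scope classical_set_scope.
Local Open Scope ring_scope.

(** The neighbourhoods of $1_G$ enter only through Bohr sets: by Bogolyubov's
    theorem, for every neighbourhood [V] of 0 and every [g] there are finitely
    many frequencies $\theta_i$ such that [g *+ r] lies in [V] as soon as all
    the reals $\theta_i r$ are close to integers ([bohr_set_in_return_times]).
    It remains to find $n \ge 1$ with $T^n u$ close to [v] and with finitely
    many monomials $\theta n^k$ simultaneously close to integers.

    The monomials are adjoined one at a time, lower degrees first.  The sets of
    times at which the previous ones are small generate an idempotent filter
    [F], and by the binomial formula the new phase [q] is additive up to errors
    that tend to 0 along [F] ([monomial_quasi_additive]).  Therefore the set
    $L(u, v)$ of limits of $q(n)$ modulo 1 along [F], as $T^n u \to v$,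
    satisfies $L(u, v) + L(v, w) \subset L(u, w)$ ([joint_limit_trans]), and
    $L(u, u)$ is a closed subgroup of the circle.  If it is the whole circle,
    then $0 \in L(u, v)$.  Otherwise it is finite, the preimage of $L(u, u)$
    in the real line is $aZ$, and for hypercyclic [v] the set $L(u, v)$ is one
    coset $f(v)$, which depends continuously on [v] and satisfies
    $f(Tv) = f(v) + f(Tu)$.

    The topological heart of the proof is that $f(Tu)$ vanishes.  The vectors
    $p(T)u$ with $p(1) = 1$ form an affine set that is invariant under [T] and
    consists of hypercyclic vectors ([HC_poly_act]).  As this set is
    contractible, [f] lifts on it to a real function $\psi$ with $\psi(u) = 0$
    and $\psi(Tv) = \psi(v) + \psi(Tu)$ ([lift_value_map]), so that
    $\psi(T^n u) = n \psi(Tu)$.  But [f] is almost constant near [u], so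
    $\psi(T^n u)$ is small when $T^n u$ returns close to [u]; this forces
    $\psi(Tu) = 0$ ([lift_value_zero]).  Hence [f] vanishes along the orbit
    of [u], and 0 belongs to $L(u, v)$ for every [v] by density
    ([joint_limit_zero]). *)

(** * Reals modulo a lattice *)

Section ModularClosenessTheory.
Variable R : realType.
Implicit Types (a e x y : R) (k : int).

(** Distances in the circle $R/aZ$ are handled through real representatives,
    without forming the quotient. *)
Definition near_lattice a e x := exists k : int, `|x - a *~ k| < e.

Lemma near_lattice_le a e e' x :
  e <= e' -> near_lattice a e x -> near_lattice a e' x.
Proof. by move=> ee' [k xk]; exists k; exact: lt_le_trans ee'. Qed.

Lemma near_latticeD a e e' x y :
  near_lattice a e x -> near_lattice a e' y -> near_lattice a (e + e') (x + y).
Proof.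
move=> [k xk] [l yl]; exists (k + l); rewrite mulrzDr.
have -> : x + y - (a *~ k + a *~ l) = (x - a *~ k) + (y - a *~ l) by ring.
by rewrite (le_lt_trans (ler_normD _ _))// ltrD.
Qed.

Lemma near_latticeN a e x : near_lattice a e x -> near_lattice a e (- x).
Proof.
move=> [k xk]; exists (- k); rewrite mulrNz.
by rewrite -opprD normrN.
Qed.

Lemma near_latticeB a e e' x y :
  near_lattice a e x -> near_lattice a e' y -> near_lattice a (e + e') (x - y).
Proof. by move=> xe /near_latticeN; exact: near_latticeD. Qed.

Lemma near_latticeMz a e x k :
  near_lattice a e x -> near_lattice a e (x + a *~ k).
Proof.
move=> [l xl]; exists (l + k); rewrite mulrzDr.
by have -> : x + a *~ k - (a *~ l + a *~ k) = x - a *~ l by ring.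
Qed.

Lemma near_lattice_small a e x : `|x| < e -> near_lattice a e x.
Proof. by move=> xe; exists 0; rewrite mulr0z subr0. Qed.

Lemma near_lattice_mulrn a e x n : 
  0 < e -> near_lattice a e x -> near_lattice a (e *+ n.+1) (x *+ n).
Proof.
move=> e0 ex; elim: n => [|n IH].
  by apply: near_lattice_small; rewrite mulr0n normr0 mulr1n.
by rewrite (mulrSr x n) (mulrSr e n.+1); exact: near_latticeD.
Qed.

(** A closed subsemigroup of the circle, seen as a set of reals invariant under
    integer translations.  If its positive elements accumulate at 0, their
    multiples are dense.  Otherwise some multiple of the least positive element
    [a] falls into $[1, 1 + a[$, hence equals 1 by minimality; this makes the
    semigroup a group. *)
Lemma closed_periodic_semigroup (H : set R) :
  H !=set0 -> (forall x y, H x -> H y -> H (x + y)) ->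
  (forall x k, H x -> H (x + k%:~R)) ->
  (forall x, (forall e, 0 < e -> exists2 y, H y & `|x - y| < e) -> H x) ->
  (forall x, H x) \/ exists2 a, 0 < a & forall x, H x <-> exists k, x = a *~ k.
Proof.
move=> [x0 Hx0] HD Hper Hcl.
have Hmul x n : H x -> H (x *+ n.+1).
  by move=> Hx; elim: n => [//|n IH]; rewrite mulrSr; exact: HD.
pose P := [set x | H x /\ 0 < x].
have P0 : P !=set0.
  exists (x0 + (1 - Num.floor x0)%:~R); split; first exact: Hper.
  by rewrite /= intrD mulrNz mulr1z; have := floor_le x0; lra.
have Plb : has_lbound P by exists 0 => x [_ /ltW].
have Pinf : has_inf P by [].
have inf0 : 0 <= inf P by apply: lb_le_inf => // x [_ /ltW].
have [inf_eq0|a0] := eqVneq (inf P) 0.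
  left=> x; apply: Hcl => e e0.
  have [h [Hh h0]] := inf_adherent e0 Pinf.
  rewrite inf_eq0 add0r => he.
  (* Translating [x] by [N] makes it exceed [h], so that the multiple of [h]
     just below it has a positive coefficient. *)
  pose N := (Num.floor (h - x) + 1)%R.
  have Nx : h < x + N%:~R.
    by have := floorD1_gt (h - x); rewrite -/N intrD mulr1z; lra.
  pose q := Num.floor ((x + N%:~R) / h).
  have q1 : 1 <= q.
    by rewrite /q floor_ge_int /= ler_pdivlMr// mul1r ltW.
  have qle : h * q%:~R <= x + N%:~R.
    by rewrite mulrC -ler_pdivlMr// floor_le.
  have ltq : x + N%:~R < h * q%:~R + h.
    have := floorD1_gt ((x + N%:~R) / h).
    by rewrite -/q ltr_pdivrMr// intrD mulr1z; lra.
  case: q q1 qle ltq => [[|n]|n]// _ qle ltq.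
  exists (h *+ n.+1 + (- N)%:~R); first exact/Hper/Hmul.
  rewrite mulrNz -mulr_natr pmulrn ltr_norml; apply/andP; split; lra.
right; set a := inf P in inf0 a0.
have {a0} inf0 : 0 < a by rewrite lt_neqAle eq_sym a0.
have Pmin x : H x -> 0 <= x -> x < a -> x = 0.
  move=> Hx x0' xa; have [//|xn0] := eqVneq x 0.
  suff : a <= x by lra.
  by apply: ge_inf => //; split => //; rewrite lt_neqAle eq_sym xn0.
have Ha : H a.
  apply: Hcl => e e0; have [h [Hh h0]] := inf_adherent e0 Pinf.
  move=> he; exists h => //; rewrite ler0_norm; first by rewrite -/a in he; lra.
  by rewrite subr_le0; apply: ge_inf.
exists a => //.
have [n [an anle]] : exists n : nat, a *+ n.+1 = 1 /\ H 0.
  pose q := Num.floor (1 / a).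
  have q0 : 0 <= q by rewrite /q floor_ge_int /= divr_ge0// ltW.
  have qle : a * q%:~R <= 1 by rewrite mulrC -ler_pdivlMr// floor_le.
  have ltq : 1 < a * q%:~R + a.
    by have := floorD1_gt (1 / a); rewrite -/q ltr_pdivrMr// intrD mulr1z; lra.
  case: q q0 qle ltq => // n _ qle ltq.
  have Hn : H (a *+ n.+1 + (-1)%:~R) by exact/Hper/Hmul.
  have an : a *+ n.+1 = a * n%:~R + a.
    by rewrite mulrSr -[a *+ n]mulr_natr pmulrn.
  have [le1|gt1] := lerP 1 (a * n%:~R); last first.
    have := Pmin _ Hn; rewrite an mulrNz mulr1z => z0.
    exists n; split.
      by rewrite an; apply/eqP; rewrite -subr_eq0; apply/eqP; apply: z0; lra.
    by have := Hn; rewrite an mulrNz mulr1z z0//; lra.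
  have an1 : a * n%:~R = 1 by lra.
  case: n an1 {le1 qle ltq Hn an} => [|n] an1; first lra.
  have an : a *+ n.+1 = 1 by rewrite -mulr_natr pmulrn.
  exists n; split => //; have := Hper _ (-1) (Hmul a n Ha).
  by rewrite an mulrNz mulr1z subrr.
have HNa : H (- a).
  case: n an => [|n] an.
    have := Hper 0 (-1) anle; rewrite mulrNz add0r; congr H; congr (- _).
    by rewrite -an mulr1n.
  have := Hper _ (-1) (Hmul a n Ha); congr H.
  rewrite mulrNz mulr1z -an (mulrSr a n.+1); ring.
have HaZ k : H (a *~ k).
  case: k => [[|n']|n']; first by rewrite mulr0z.
    by rewrite -pmulrn; exact: Hmul.
  by rewrite NegzE mulrNz -pmulrn -mulNrn; exact: Hmul.
move=> x; split=> [Hx|[k ->//]].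
pose q := Num.floor (x / a).
exists q; apply/eqP; rewrite -subr_eq0; apply/eqP; apply: Pmin.
- by rewrite -mulrNz; apply: HD.
- by rewrite subr_ge0 -mulrzl -ler_pdivlMr// floor_le.
- have := floorD1_gt (x / a); rewrite -/q ltr_pdivrMr// intrD mulrDl mul1r mulrzl; lra.
Qed.

End ModularClosenessTheory.

(** * Lifting of circle-valued maps *)

Section CircleLifting.
Variables (R : realType) (a : R).
Implicit Types (e x y r s : R) (k : int).

(** For $a > 0$, the representative of [x] modulo [a] in $[-a/2, a/2[$. *)
Definition lattice_residue x := x - a *~ Num.floor (x / a + 2^-1).

Lemma lattice_residueE x k : 0 < a ->
  `|x - a *~ k| < a / 2 -> lattice_residue x = x - a *~ k.
Proof.
move=> a0 xk; congr (_ - a *~ _); apply/eqP; rewrite floor_eq/= intrD mulr1z.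
have {xk} : `|x / a - k%:~R| < 2^-1.
  have -> : x / a - k%:~R = (x - a *~ k) / a.
    by rewrite -(mulrzr a) mulrBl [a * _]mulrC mulfK// gt_eqF.
  rewrite normrM (gtr0_norm (x := a^-1)) ?invr_gt0// ltr_pdivrMr//; lra.
by rewrite ltr_norml => /andP[? ?]; apply/andP; split; lra.
Qed.

Lemma lattice_residueB e x y : 0 < a -> e <= a / 4 ->
  near_lattice a (a / 4) x -> near_lattice a e (y - x) ->
  `|lattice_residue y - lattice_residue x| < e.
Proof.
move=> a0 ea [k xk] [l yxl].
rewrite (@lattice_residueE x k)//; last by lra.
rewrite (@lattice_residueE y (k + l))// mulrzDr.
  by have -> : y - (a *~ k + a *~ l) - (x - a *~ k) = y - x - a *~ l by ring.
have -> : y - (a *~ k + a *~ l) = (x - a *~ k) + (y - x - a *~ l) by ring.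
by rewrite (le_lt_trans (ler_normD _ _))//; lra.
Qed.

(** Path lifting for the covering $R \to R/aZ$, with a parameter [s]: the map
    $f \bmod a$ is lifted along each ray $r \mapsto (r, s)$.  By compactness of
    the square, [f] moves by less than $a/4$ modulo [a] over every horizontal
    step of length $1/N$; the lift is the sum of the small representatives of
    these [N] increments, each of which depends continuously on $(r, s)$. *)
Lemma lift_along_rays (f : R * R -> R) : 0 < a ->
    (forall P e, 0 < e -> \forall Q \near P, near_lattice a e (f Q - f P)) ->
  exists theta : R * R -> R, forall r s, 0 <= r <= 1 -> 0 <= s <= 1 ->
    [/\ theta Q @[Q --> (r, s)] --> theta (r, s),
        exists k, theta (r, s) = f (r, s) - f (0, s) + a *~ k
      & theta (0, s) = 0].
Proof.
move=> a0 fc.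
have a4 : 0 < a / 4 by lra.
pose step h (P : R * R) := near_lattice a (a / 4) (f (P.1 + h, P.2) - f P).
have : \forall h \near 0, `[0, 1] `*` `[0, 1] `<=` step h.
  have K : compact (`[0, 1] `*` `[0, 1] : set (R * R)).
    by apply: compact_setX; exact: segment_compact.
  apply: (proj1 (compact_near_coveringP _) K R (nbhs (0 : R)) step) => P _.
  have shift : (fun z : (R * R) * R => (z.1.1 + z.2, z.1.2)) @ (P, 0) -->
      (P.1 + 0, P.2).
    apply: (cvg_pair (G := nbhs (P.1 + 0)) (H := nbhs P.2)) => /=.
      2: by apply: cvg_comp cvg_fst cvg_snd.
    by apply: cvgD; [apply: cvg_comp cvg_fst cvg_fst|exact: cvg_snd].
  have e8 : 0 < a / 8 by lra.
  have f1 : (nbhs (P, 0 : R)) (fun z =>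
      near_lattice a (a / 8) (f (z.1.1 + z.2, z.1.2) - f (P.1 + 0, P.2))).
    exact: shift (fc (P.1 + 0, P.2) _ e8).
  have f2 : (nbhs (P, 0 : R)) (fun z => near_lattice a (a / 8) (f z.1 - f P)).
    exact: (@cvg_fst _ _ (nbhs P) (nbhs (0 : R)) _ _ (fc P _ e8)).
  suff : nbhs (P, 0 : R) (fun z => step z.2 z.1) by [].
  apply: (filterS _ (filterI f1 f2)) => -[Q h] [/= fQh fQ]; rewrite /step/=.
  rewrite addr0 -surjective_pairing in fQh.
  apply: (@near_lattice_le _ _ (a / 8 + a / 8)); first lra.
  have := near_latticeB fQh fQ; congr near_lattice; ring.
move=> /nbhs_ballP[d /= d0 dstep].
have [N Nd] : exists N, N.+1%:R^-1 < d.
  have [N Nd] : exists N, d^-1 < N.+1%:R.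
    exists `|Num.floor d^-1|%N.
    have := floorD1_gt d^-1; rewrite intrD mulr1z -natr1.
    move/lt_le_trans; apply; rewrite lerD2r natr_absz ler_int ler_norm//.
  by exists N; rewrite -[d]invrK ltf_pV2// posrE ?invr_gt0.
pose c (k : nat) : R := k%:R / N.+1%:R.
pose D (k : nat) (P : R * R) := f (P.1 * c k.+1, P.2) - f (P.1 * c k, P.2).
exists (fun P => \sum_(k < N.+1) lattice_residue (D k P)) => r s r01 s01.
have D4 (k : 'I_N.+1) : near_lattice a (a / 4) (D k (r, s)).
  have k1 : (c k <= 1).
    by rewrite /c ler_pdivrMr// mul1r ler_nat ltnW.
  have c0 : 0 <= c k by rewrite divr_ge0.
  have := dstep (r / N.+1%:R) _ (r * c k, s).
  have cS : c k.+1 = c k + N.+1%:R^-1 by rewrite /c -(natr1 k) mulrDl mul1r.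
  rewrite /step /D/= cS mulrDr; apply.
    rewrite /ball/= sub0r normrN normrM ger0_norm; last by case/andP: r01.
    rewrite ger0_norm ?invr_ge0//; apply: le_lt_trans Nd.
    by rewrite ler_piMl ?invr_ge0//; case/andP: r01.
  split; rewrite /= in_itv/=; last by [].
  case/andP: r01 => r0 r1; apply/andP; split; first exact: mulr_ge0.
  by rewrite mulr_ile1.
split.
- apply: cvg_big => [|k _]; first exact: add_continuous.
  apply/cvgrPdist_lt => e e0.
  pose e' := Num.min e (a / 4).
  have e'0 : 0 < e' / 2 by rewrite divr_gt0// lt_min e0.
  have fck x : \forall Q \near (r, s),
      near_lattice a (e' / 2) (f (Q.1 * x, Q.2) - f (r * x, s)).
    have sc : (fun Q : R * R => (Q.1 * x, Q.2)) @ (r, s) --> (r * x, s).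
      apply: (cvg_pair (G := nbhs (r * x)) (H := nbhs s)) => /=; last exact: cvg_snd.
      by apply: cvgMl; exact: cvg_fst.
    exact: sc (fc _ _ e'0).
  move: (fck (c k.+1)) (fck (c k)); apply: filterS2 => Q f1 f2.
  rewrite distrC; apply: (@lt_le_trans _ _ e'); last by rewrite ge_min lexx.
  apply: lattice_residueB a0 _ (D4 k) _; first by rewrite ge_min lexx orbT.
  have := near_latticeB f1 f2; rewrite -splitr; congr near_lattice.
  rewrite /D/=; ring.
- have tele n : \sum_(k < n) D k (r, s) = f (r * c n, s) - f (r * c 0%N, s).
    elim: n => [|n IH]; first by rewrite big_ord0 subrr.
    rewrite big_ord_recr/= IH /D/=; ring.
  exists (\sum_(k < N.+1) - Num.floor (D k (r, s) / a + 2^-1)).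
  rewrite /lattice_residue sumrB tele /c mul0r mulr0 divff// mulr1.
  congr (_ + _); rewrite -sumrN.
  elim/big_ind2 : _ => [|x1 x2 y1 y2 -> ->|k _]; rewrite ?mulr0z ?mulrzDr//.
  by rewrite mulrNz.
- rewrite big1// => k _; rewrite /D/= !mul0r subrr.
  by rewrite (@lattice_residueE _ 0)// ?mulr0z ?subr0// normr0; lra.
Qed.

(** A real path that starts at 0 and stays within $e \le a/2$ of the lattice
    cannot jump to another lattice point. *)
Lemma path_near_lattice e (g : R -> R) : 0 < a -> e <= a / 2 ->
    (forall t : R, 0 <= t <= 1 -> g x @[x --> t] --> g t) -> g 0 = 0 ->
    (forall t, 0 <= t <= 1 -> near_lattice a e (g t)) ->
  `|g 1| < e.
Proof.
move=> a0 ea.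
suff key (h : R -> R) :
    (forall t : R, 0 <= t <= 1 -> h x @[x --> t] --> h t) -> h 0 = 0 ->
    (forall t, 0 <= t <= 1 -> near_lattice a e (h t)) -> h 1 < e.
  move=> gc g0 gl; rewrite ltr_norml ltrNl; apply/andP; split; last exact: key.
  apply: (key (fun t => - g t)); last 1 first.
  - by move=> t t01; apply: near_latticeN; exact: gl.
  - by move=> t t01; apply: cvgN; exact: gc.
  - by rewrite g0 oppr0.
move=> hc h0 hl; rewrite ltNge; apply/negP => eh1.
(* The nearest lattice point to [h 1] is positive, so [h 1] is beyond $a/2$,
   a value at distance $a/2$ from the lattice. *)
have h1 : a / 2 <= h 1.
  have [|k hk] := hl 1; first by rewrite ler01 lexx.
  have [k0|k0] := lerP k 0.
    have : a *~ k <= a *~ 0 by rewrite ler_pMz2l.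
    rewrite mulr0z => ak; move: hk; rewrite ltr_norml => /andP[] *; lra.
  have : a *~ 1 <= a *~ k by rewrite ler_pMz2l.
  rewrite mulr1z; move: hk; rewrite ltr_norml => /andP[] *; lra.
have [t t01 ht] : exists2 t, t \in `[0, 1] & h t = a / 2.
  apply: IVT => //.
    by apply: continuous_in_subspaceT => t; rewrite inE/= in_itv/=; exact: hc.
  by rewrite h0 min_l ?max_r ?h1; lra.
have [|k] := hl t; first by move: t01; rewrite in_itv.
rewrite ht => hk.
have [k0|k0] := lerP k 0.
  have : a *~ k <= a *~ 0 by rewrite ler_pMz2l.
  rewrite mulr0z => ak; move: hk; rewrite ltr_norml => /andP[] *; lra.
have : a *~ 1 <= a *~ k by rewrite ler_pMz2l.
rewrite mulr1z; move: hk; rewrite ltr_norml => /andP[] *; lra.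
Qed.

Lemma path_in_lattice (g : R -> R) : 0 < a ->
    (forall t : R, 0 <= t <= 1 -> g x @[x --> t] --> g t) ->
    (forall t, 0 <= t <= 1 -> exists k, g t - g 0 = a *~ k) ->
  g 1 = g 0.
Proof.
move=> a0 gc gl; apply/eqP; rewrite -subr_eq0 -normr_le0; apply/ler_addgt0Pr => e e0.
rewrite add0r; apply: ltW; apply: (@lt_le_trans _ _ (Num.min e (a / 2))); last first.
  by rewrite ge_min lexx.
apply: (@path_near_lattice _ (fun t => g t - g 0)) => //.
- by rewrite ge_min lexx orbT.
- by move=> t t01; apply: cvgB; [exact: gc|exact: cvg_cst].
- exact: subrr.
- move=> t /gl[k ->]; exists k; rewrite subrr normr0 lt_min e0; lra.
Qed.

End CircleLifting.

(** * Hypercyclic vectors and polynomials of the operator *)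

Section HypercyclicVectors.
Variables (R : realType) (X : topologicalLmodType R[i]).
Implicit Types (u v w : X) (c lam : R[i]) (p q : {poly R[i]}).

Lemma addr_cvg (I : Type) (F : set_system I) {FF : Filter F} (f g : I -> X) v w :
  f @ F --> v -> g @ F --> w -> f i + g i @[i --> F] --> v + w.
Proof.
move=> fv gw.
have add_vw : z.1 + z.2 @[z --> (v, w)] --> v + w := add_continuous (v, w).
exact: cvg_comp (cvg_pair (G := nbhs v) (H := nbhs w) fv gw) add_vw.
Qed.

Lemma scaler_cvg (I : Type) (F : set_system I) {FF : Filter F}
    (f : I -> R[i]^o) (g : I -> X) (c : R[i]^o) w :
  f @ F --> c -> g @ F --> w -> f i *: g i @[i --> F] --> c *: w.
Proof.
move=> fc gw.
have scale_cw : z.1 *: z.2 @[z --> (c, w)] --> c *: w := scale_continuous (c, w).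
exact: cvg_comp (cvg_pair (G := nbhs c) (H := nbhs w) fc gw) scale_cw.
Qed.

Lemma scaler_continuous_at c v : c *: w @[w --> v] --> c *: v.
Proof. by apply: scaler_cvg; [exact: cvg_cst|exact: cvg_id]. Qed.

Lemma addr_continuous_at u v : u + w @[w --> v] --> u + v.
Proof. by apply: addr_cvg; [exact: cvg_cst|exact: cvg_id]. Qed.

(** By continuity of the scaling at $(0, 0)$, all small multiples of some
    neighbourhood of 0 lie in [W]; a rescaled copy of it then has the property
    that a balanced neighbourhood would have. *)
Lemma absorbing_nbhs (W : set X) : nbhs 0 W ->
  exists2 W', nbhs 0 W' & forall c w, 1 <= `|c| -> W' w -> W (c^-1 *: w).
Proof.
move=> W0.
have s00 : z.1 *: z.2 @[z --> (0 : R[i]^o, 0 : X)] --> (0 : R[i]) *: (0 : X) :=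
  scale_continuous (0, 0).
rewrite scaler0 in s00; have [[B W1] /= [[d /= d0 dB] W10] BW] := s00 _ W0.
pose b := d / 2; have b0 : 0 < b by rewrite divr_gt0.
exists ((fun w => b^-1 *: w) @^-1` W1).
  by apply: scaler_continuous_at; rewrite scaler0.
move=> c w c1 /= Ww.
have -> : c^-1 *: w = (c^-1 * b) *: (b^-1 *: w).
  by rewrite scalerA mulfK// gt_eqF.
apply: (BW (_, _)); split => //=; apply: dB => /=.
rewrite sub0r normrN normrM normfV (gtr0_norm b0).
apply: (@le_lt_trans _ _ b).
  by apply: ler_piMl; [exact: ltW|rewrite invf_le1// (lt_le_trans ltr01)].
by rewrite /b ltr_pdivrMr// ltr_pMr// ltrDl.
Qed.

Variable T : {linear X -> X}.
Hypothesis T_continuous : continuous (T : X -> X).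

Lemma iter_linearP n c v w :
  iter n T (c *: v + w) = c *: iter n T v + iter n T w.
Proof. by elim: n => //= n ->; rewrite linearP. Qed.

Lemma HC_nbhs u v (O : set X) : HC T u -> nbhs v O -> exists n, O (iter n T u).
Proof.
move=> uHC Ov; have [||x [Ox [n _ nx]]] := uHC O°.
- by exists v.
- exact: open_interior.
- by exists n; rewrite nx; exact: interior_subset.
Qed.

Lemma scalar_power_far lam : exists c, forall n, 1 <= `|c - lam ^+ n|.
Proof.
have /orP[lam1|lam1] : (`|lam| <= 1) || (1 <= `|lam|).
  exact: real_leVge (normr_real _) (real1 _).
  (* For $|\lambda| \le 1$ the powers stay in the unit disc, far from 2;
     otherwise they stay outside it, far from 0. *)
  exists 2 => n; have : `|lam ^+ n| <= 1 by rewrite normrX exprn_ile1.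
  move=> le1; have := lerB_dist 2 (lam ^+ n); apply: le_trans.
  by rewrite ger0_norm// lerBrDr (_ : 2 = 1 + 1)// lerD2l.
by exists 0 => n; rewrite sub0r normrN normrX exprn_ege1.
Qed.

(** If the range of $T - \lambda$ avoided an open set, some neighbourhood
    $u + W$ of the hypercyclic vector [u] would avoid it, because the range
    contains $T^n u - \lambda^n u$.  Some scalar [c] stays at distance at
    least 1 from all the $\lambda^n$; an orbit point $T^m u$ close to $c u$ then
    yields, after division by $c - \lambda^m$, a point of the range close
    to [u]. *)
Lemma range_sub_scalar_dense u lam (O : set X) v : HC T u -> nbhs v O ->
  exists x, O (T x - lam *: x).
Proof.
move=> uHC Ov; apply: contrapT => /forallNP noO.
pose rg := range (fun x => T x - lam *: x).
have rgP y : rg y <-> exists x, y = T x - lam *: x.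
  by split=> [[x _ <-]|[x ->]]; [exists x|exists x].
have rgD c y z : rg y -> rg z -> rg (c *: y + z).
  move=> [x _ <-] [x' _ <-]; exists (c *: x + x') => //.
  by rewrite linearP scalerDr !scalerBr !scalerA mulrC opprD addrACA.
have rg0 : rg 0 by exists 0 => //; rewrite linear0 scaler0 subr0.
have rgZ c y : rg y -> rg (c *: y) by move=> ?; rewrite -[_ *: _]addr0; exact: rgD.
have rg_orbit n : rg (iter n T u - lam ^+ n *: u).
  elim: n => [|n IH]; first by rewrite expr0 scale1r subrr.
  have -> : iter n.+1 T u - lam ^+ n.+1 *: u = lam *: (iter n T u - lam ^+ n *: u)
      + (T (iter n T u) - lam *: iter n T u).
    by rewrite scalerBr scalerA -exprS [RHS]addrC addrA subrK.
  by apply: rgD => //; exists (iter n T u).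
have [n On] : exists n, O° (iter n T u).
  by apply: (HC_nbhs (v := v)) => //; exact: nbhs_interior.
pose r := iter n T u - lam ^+ n *: u.
have nr y : rg y -> ~ O (lam ^+ n *: y + r).
  move=> ry Oy; have [x _ xy] := rgD (lam ^+ n) y r ry (rg_orbit n).
  by apply: (noO x); rewrite xy.
(* The map $y \mapsto \lambda^n y + r$ preserves the range and sends [u] to
   $T^n u$, which lies in [O]; so $u + w$ is outside the range for [w] in [W]. *)
pose W := [set w | O (lam ^+ n *: (u + w) + r)].
have W0 : nbhs 0 W.
  have cW : lam ^+ n *: (u + w) + r @[w --> 0] --> lam ^+ n *: (u + 0) + r.
    apply: addr_cvg (cvg_cst _).
    by apply: scaler_cvg; [exact: cvg_cst|exact: addr_continuous_at].
  by apply: cW; rewrite addr0 addrC subrK.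
have [W' W'0 WW'] := absorbing_nbhs W0.
have [c c1] := scalar_power_far lam.
have nb : nbhs (c *: u) [set z | W' (z - c *: u)].
  have cW : z - c *: u @[z --> c *: u] --> c *: u - c *: u.
    exact: addr_cvg cvg_id (cvg_cst _).
  by apply: cW; rewrite subrr.
have [m Wm] := HC_nbhs uHC nb.
have {Wm} := WW' _ _ (c1 m) Wm.
have cm0 : c - lam ^+ m != 0 by rewrite -normr_gt0 (lt_le_trans ltr01).
pose r' := iter m T u - lam ^+ m *: u.
have -> : iter m T u - c *: u = r' - (c - lam ^+ m) *: u.
  by rewrite /r' scalerBl opprB addrA subrK.
rewrite scalerBr scalerA mulVf// scale1r /W/= subrKC => Wm.
by apply: nr Wm; apply: rgZ; exact: rg_orbit.
Qed.

Lemma HC_sub_scalar u lam : HC T u -> HC T (T u - lam *: u).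
Proof.
move=> uHC O [v Ov] Oo.
have [x Ox] := range_sub_scalar_dense lam uHC (open_nbhs_nbhs (conj Oo Ov)).
rewrite -scaleNr in Ox.
have cx : T z + - lam *: z @[z --> x] --> T x + - lam *: x.
  apply: addr_cvg; first exact: T_continuous.
  exact: scaler_continuous_at.
have [n On] := HC_nbhs uHC (cx _ (open_nbhs_nbhs (conj Oo Ox))).
exists (iter n T (T u - lam *: u)); split; last by exists n.
have -> : T u - lam *: u = - lam *: u + T u by rewrite scaleNr addrC.
by rewrite iter_linearP addrC -iterSr.
Qed.

Lemma HC_map u : HC T u -> HC T (T u).
Proof. by move=> /(HC_sub_scalar 0); rewrite scale0r subr0. Qed.

Lemma HC_nbhs_pos u v (O : set X) : HC T u -> nbhs v O ->
  exists n, O (iter n.+1 T u).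
Proof.
by move=> /HC_map uHC /(HC_nbhs uHC)[n]; rewrite -iterSr; exists n.
Qed.

(** [poly_act p u] is $p(T)u$. *)
Definition poly_act p u := \sum_(i < size p) p`_i *: iter i T u.

Lemma poly_actE n p u : (size p <= n)%N ->
  poly_act p u = \sum_(i < n) p`_i *: iter i T u.
Proof.
move=> pn; rewrite /poly_act (big_ord_widen n (fun i => p`_i *: iter i T u))//.
rewrite big_mkcond; apply: eq_bigr => i _; case: ltnP => // /leq_sizeP.
by move=> /(_ i (leqnn _)) ->; rewrite scale0r.
Qed.

Lemma poly_act_linear c p q u :
  poly_act (c *: p + q) u = c *: poly_act p u + poly_act q u.
Proof.
pose n := maxn (size p) (size q).
have ps : (size p <= n)%N by rewrite leq_maxl.
have qs : (size q <= n)%N by rewrite leq_maxr.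
rewrite (poly_actE u ps) (poly_actE u qs) (@poly_actE n); last first.
  rewrite (leq_trans (size_polyD _ _))// geq_max qs andbT.
  exact: leq_trans (size_scale_leq _ _) ps.
rewrite scaler_sumr -big_split; apply: eq_bigr => i _ /=.
by rewrite coefD coefZ scalerDl scalerA.
Qed.

Lemma poly_actMX p u : poly_act (p * 'X) u = T (poly_act p u).
Proof.
rewrite (@poly_actE (size p).+1); last first.
  by rewrite (leq_trans (size_polyMleq _ _))// size_polyX addn2.
rewrite big_ord_recl coefMX eqxx scale0r add0r /poly_act linear_sum.
by apply: eq_bigr => i _; rewrite coefMX/= linearZ.
Qed.

Lemma poly_actC c u : poly_act c%:P u = c *: u.
Proof.
by rewrite (@poly_actE 1) ?size_polyC_leq1// big_ord1 coefC eqxx.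
Qed.

(** Bourdon's theorem: $p(T)u$ is hypercyclic for every nonzero polynomial [p],
    because [p] splits into linear factors over the complex numbers. *)
Lemma HC_poly_act p u : HC T u -> p != 0 -> HC T (poly_act p u).
Proof.
move=> uHC; have [n] := ubnP (size p); elim: n p => // n IH p pn p0.
have [/size_poly1P[c c0 ->]|] := boolP (size p == 1%N).
  rewrite poly_actC => O [v Ov] Oo.
  have cc : c *: z @[z --> c^-1 *: v] --> v.
    by have := @scaler_continuous_at c (c^-1 *: v); rewrite scalerA divff// scale1r.
  have [m Om] := HC_nbhs uHC (cc _ (open_nbhs_nbhs (conj Oo Ov))).
  exists (iter m T (c *: u)); split; last by exists m.
  have -> // : iter m T (c *: u) = c *: iter m T u.
  by elim: (m) => //= k ->; rewrite linearZ.
move=> /closed_rootP[lam /factor_theorem[q pq]].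
have q0 : q != 0 by apply: contraNneq p0 => q0; rewrite pq q0 mul0r.
have -> : poly_act p u = T (poly_act q u) - lam *: poly_act q u.
  have -> : p = - lam *: q + q * 'X.
    by rewrite pq mulrBr addrC mulrC mul_polyC scaleNr.
  by rewrite poly_act_linear poly_actMX scaleNr addrC.
apply/HC_sub_scalar/IH => //.
by move: pn; rewrite pq size_Mmonic ?monicXsubC// size_XsubC addn2.
Qed.

End HypercyclicVectors.

(** * Joint limits of orbits and phases *)

Section JointReturns.
Variables (R : realType) (X : topologicalType) (T : X -> X).
Implicit Types (F : set_system nat) (u v w : X) (x y e : R).

(** $F \subset F * F$ for the convolution of filters on the additive semigroup
    of the natural numbers, as for an idempotent ultrafilter. *)
Definition idempotent F := forall A, F A ->
  exists2 B, F B & forall m, B m -> F [set n | A (n + m)%N].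

Definition visits_along F := forall u v O A, HC T u -> nbhs v O -> F A ->
  exists2 n, A n & O (iter n T u).

(** Modulo 1 and along [F], the map [q] behaves like a homomorphism. *)
Definition quasi_additive F (q : nat -> R) := forall m e, 0 < e ->
  F [set n | near_lattice 1 e (q (n + m)%N - q n - q m)].

Section Relation.
Variables (F : set_system nat) (q : nat -> R).
Hypothesis T_continuous : continuous T.

(** [(v, x)] is a cluster point along [F] of $(T^n u, q(n))$, the second
    component being taken modulo 1. *)
Definition joint_limit u v x := forall O A e, nbhs v O -> F A -> 0 < e ->
  exists n, [/\ A n, O (iter n T u) & near_lattice 1 e (q n - x)].

Lemma joint_limit_shift u v x (k : int) :
  joint_limit u v x -> joint_limit u v (x + k%:~R).
Proof.
move=> uvx O A e Ov FA e0; have [n [An On qn]] := uvx O A e Ov FA e0.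
exists n; split => //; have := near_latticeMz (- k) qn.
by rewrite mulrNz opprD addrA.
Qed.

Lemma joint_limit_closed u v x :
  (forall O e, nbhs v O -> 0 < e ->
    exists w y, [/\ O w, `|x - y| < e & joint_limit u w y]) ->
  joint_limit u v x.
Proof.
move=> lim O A e Ov FA e0.
have e20 : 0 < e / 2 by rewrite divr_gt0.
have [w [y [Ow xy uwy]]] := lim _ _ (nbhs_interior Ov) e20.
have [n [An On qn]] := uwy _ _ _ Ow FA e20.
exists n; split => //.
have := near_latticeD qn (near_lattice_small 1 (x := y - x) _).
move=> /(_ (e / 2)); rewrite distrC -splitr => /(_ xy).
by rewrite addrA subrK.
Qed.

Lemma joint_limit_map u v x : joint_limit u v x -> joint_limit (T u) (T v) x.
Proof.
move=> uvx O A e Ov FA e0; have [n [An On qn]] := uvx _ A e (T_continuous Ov) FA e0.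
by exists n; split => //; rewrite -iterSr.
Qed.

Lemma iter_continuous n : continuous (iter n T).
Proof.
elim: n => [|n IH] v; first exact: cvg_id.
by move=> O /T_continuous/IH.
Qed.

Hypothesis F_filter : Filter F.

(** First go from [v] to near [w] in time [m], then choose [n] so that $T^n u$
    is close enough to [v] for $T^{n+m} u$ to be close to [w]; idempotence of
    [F] lets [n] depend on [m]. *)
Lemma joint_limit_trans u v w x y : idempotent F -> quasi_additive F q ->
  joint_limit u v x -> joint_limit v w y -> joint_limit u w (x + y).
Proof.
move=> Fidem qF uvx vwy O A e Ow FA e0.
have e30 : 0 < e / 3 by rewrite divr_gt0.
have [B FB AB] := Fidem A FA.
have [m [Bm Om qm]] := vwy _ B _ (nbhs_interior Ow) FB e30.
have [n [[An qnm] On qn]] := uvx _ _ _ (iter_continuous Om)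
  (filterI (AB m Bm) (qF m _ e30)) e30.
exists (n + m)%N; split => //; first by rewrite addnC iterD.
have := near_latticeD qnm (near_latticeD qn qm).
rewrite (_ : e / 3 + (e / 3 + e / 3) = e); last by field.
by congr near_lattice; ring.
Qed.

(** Cluster points exist because the circle is compact. *)
Lemma joint_limit_exists u v : visits_along F -> HC T u ->
  exists x, joint_limit u v x.
Proof.
move=> visF uHC.
pose frac n := q n - (Num.floor (q n))%:~R.
pose D := [set OA : set X * set nat | nbhs v OA.1 /\ F OA.2].
pose H := filter_from D (fun OA => [set n | OA.2 n /\ OA.1 (iter n T u)]).
have HF : ProperFilter H.
  apply: filter_from_proper.
    apply: filter_from_filter.
      by exists (setT, setT); split; exact: filterT.
    move=> [U A] [U' A'] [/= Ov FA] [/= O'v FA'].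
    exists (U `&` U', A `&` A'); first by split; exact: filterI.
    by move=> n [[An A'n] [On O'n]].
  move=> [U A] [/= Ov FA]; have [n An On] := visF u v U A uHC Ov FA.
  by exists n.
have [|x [_ xcl]] := @segment_compact R 0 1 (frac @ H) _.
  exists (setT, setT); first by split; exact: filterT.
  move=> n _ /=; rewrite in_itv/= /frac.
  have := floor_le (q n); have := floorD1_gt (q n); rewrite intrD mulr1z.
  by move=> h1 h2; apply/andP; split; lra.
exists x => O A e Ov FA e0.
have [|y [[n [An On] ny] /= xy]] :=
  xcl (frac @` [set n | A n /\ O (iter n T u)]) (ball x e) _ (nbhsx_ballx _ _ e0).
  exists (O, A); first by split.
  by move=> n [An On]; exists n.
exists n; split => //; exists (Num.floor (q n)).
move: xy; rewrite /ball/= -ny /frac distrC; congr (`|_| < _); ring.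
Qed.

(** Where $x_0$ is the only limit modulo [a], the limits at nearby vectors are
    close to $x_0$ modulo [a]: by compactness of the circle, bad limits at
    vectors approaching [v] would accumulate at a bad limit at [v]. *)
Lemma joint_limit_continuous a u v x0 :
    (exists k : int, 1 = a *~ k) ->
    (forall x, joint_limit u v x -> exists k : int, x - x0 = a *~ k) ->
  forall e, 0 < e -> \forall w \near v,
    forall y, joint_limit u w y -> near_lattice a e (y - x0).
Proof.
move=> [k1 ak1] uniq e e0; apply: contrapT => bad.
pose S (O : set X) := [set y : R | [/\ 0 <= y <= 1, ~ near_lattice a e (y - x0) &
  exists2 w, O w & joint_limit u w y]].
pose H := filter_from (nbhs v) S.
have HF : ProperFilter H.
  apply: filter_from_proper.
    apply: filter_from_filter; first by exists setT; exact: filterT.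
    move=> O O' Ov O'v; exists (O `&` O'); first exact: filterI.
    by move=> y [y01 yb [w [Ow O'w] uwy]]; split; split => //; exists w.
  move=> O Ov; apply: contrapT => S0; apply: bad.
  apply: filterS Ov => w Ow y uwy; apply: contrapT => ybad; apply: S0.
  exists (y + (- Num.floor y)%:~R); split.
  - have := floor_le y; have := floorD1_gt y; rewrite intrD mulr1z mulrNz.
    by move=> h1 h2; apply/andP; split; lra.
  - move=> /(near_latticeMz (k1 * Num.floor y)); rewrite mulrzA -ak1 mulrNz.
    by rewrite (_ : _ + _ = y - x0)//; ring.
  - by exists w => //; exact: joint_limit_shift.
have [|x [_ xcl]] := @segment_compact R 0 1 H HF.
  by exists setT; [exact: filterT|move=> y [y01 _ _]; rewrite /= in_itv].
have [|k xk] := uniq x.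
  apply: joint_limit_closed => O e' Ov e'0.
  have [|y [[_ _ [w Ow uwy]] xy]] := xcl (S O) (ball x e') _ (nbhsx_ballx _ _ e'0).
    by exists O.
  by exists w, y.
have [|y [[_ yb _] xy]] := xcl (S setT) (ball x e) _ (nbhsx_ballx _ _ e0).
  by exists setT => //; exact: filterT.
apply: yb; exists k; move: xy; rewrite /ball/= distrC -xk.
by congr (`|_| < _); ring.
Qed.

End Relation.
End JointReturns.

(** * Lifting over the affine hull of an orbit *)

Section Winding.
Local Open Scope complex_scope.
Variables (R : realType) (X : topologicalLmodType R[i]) (T : {linear X -> X}).
Hypothesis T_continuous : continuous T.
Implicit Types (u v w z : X) (r s t e a : R).

Lemma real_complex_cvg (I : Type) (F : set_system I) {FF : Filter F}
    (f : I -> R) t :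
  f @ F --> t -> (fun i => (f i)%:C : R[i]^o) @ F --> (t%:C : R[i]^o).
Proof.
move=> ft A [[d d'] /= d0 dA].
move: d0; rewrite ltcE/= => /andP[/eqP d'0 d0].
move/cvgrPdist_lt : ft => /(_ d d0); apply: filterS => i tfi.
apply: dA => /=; rewrite -rmorphB/= normc_def/= expr0n addr0 sqrtr_sqr.
by rewrite d'0 ltcR.
Qed.

Definition segment_pt v w t := v + t%:C *: (w - v).

Lemma segment_pt0 v w : segment_pt v w 0 = v.
Proof. by rewrite /segment_pt scale0r addr0. Qed.

Lemma segment_pt1 v w : segment_pt v w 1 = w.
Proof. by rewrite /segment_pt scale1r addrC subrK. Qed.

Lemma segment_ptvv v t : segment_pt v v t = v.
Proof. by rewrite /segment_pt subrr scaler0 addr0. Qed.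

Lemma segment_pt_map v w t : T (segment_pt v w t) = segment_pt (T v) (T w) t.
Proof. by rewrite /segment_pt linearD linearZ linearB. Qed.

Lemma segment_pt_cvg (I : Type) (F : set_system I) {FF : Filter F}
    (f g : I -> X) (h : I -> R) v w t :
  f @ F --> v -> g @ F --> w -> h @ F --> t ->
  segment_pt (f i) (g i) (h i) @[i --> F] --> segment_pt v w t.
Proof.
move=> fv gw ht; apply: addr_cvg => //; apply: scaler_cvg.
  exact: real_complex_cvg.
apply: addr_cvg => //; apply: cvg_comp fv _; exact: opp_continuous.
Qed.

Lemma star_shaped_nbhs u (O : set X) : nbhs u O ->
  exists2 O', nbhs u O' & forall v t, O' v -> 0 <= t <= 1 -> O (segment_pt u v t).
Proof.
move=> Ou; pose W := [set w | O (u + w)].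
have W0 : nbhs 0 W by apply: addr_continuous_at; rewrite addr0.
have [W' W'0 WW'] := absorbing_nbhs W0.
exists [set v | W' (v - u)].
  have subu : v - u @[v --> u] --> u - u.
    by apply: addr_cvg; [exact: cvg_id|exact: cvg_cst].
  by apply: subu; rewrite subrr.
move=> v t /= W'v /andP[]; rewrite le_eqVlt => /orP[/eqP <- _|t0 t1].
  by rewrite segment_pt0; exact: nbhs_singleton.
have := WW' t%:C^-1 (v - u) _ W'v; rewrite invrK; apply.
rewrite normfV -[1]invr1 lef_pV2 ?posrE ?normr_gt0//.
  rewrite normc_def/= expr0n addr0 sqrtr_sqr ger0_norm ?(ltW t0)//.
  by rewrite -[1]/(1%:C) lecR.
by rewrite (inj_eq (@complexI R) t 0) gt_eqF.
Qed.

(** The affine hull of the orbit of [u].  The normalisation $p(1) = 1$ is stable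
    under affine combinations and under multiplication by the variable, and it
    excludes $p = 0$. *)
Definition affine_orbit u :=
  [set x | exists2 p : {poly R[i]}, p.[1] = 1 & x = poly_act T p u].

Lemma affine_orbit_id u : affine_orbit u u.
Proof.
by exists 1%:P; rewrite ?hornerC// poly_actC scale1r.
Qed.

Lemma affine_orbit_map u v : affine_orbit u v -> affine_orbit u (T v).
Proof.
by move=> [p p1 ->]; exists (p * 'X); rewrite ?hornerMX ?p1 ?mulr1// poly_actMX.
Qed.

Lemma affine_orbit_iter u n : affine_orbit u (iter n T u).
Proof.
by elim: n => [|n IH]; [exact: affine_orbit_id|exact: affine_orbit_map].
Qed.

Lemma affine_orbit_segment u v w t :
  affine_orbit u v -> affine_orbit u w -> affine_orbit u (segment_pt v w t).
Proof.
move=> [p p1 ->] [q q1 ->]; exists (t%:C *: q + (1 - t%:C) *: p).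
  by rewrite !hornerE p1 q1 !mulr1 addrC subrK.
rewrite poly_act_linear -[(1 - _) *: p]addr0 poly_act_linear.
have -> : poly_act T 0 u = 0 by rewrite /poly_act size_poly0 big_ord0.
by rewrite addr0 /segment_pt scalerBr scalerBl scale1r addrCA.
Qed.

Lemma HC_affine_orbit u v : HC T u -> affine_orbit u v -> HC T v.
Proof.
move=> uHC [p p1 ->]; apply: HC_poly_act => //.
by apply: contra_eq_neq p1 => ->; rewrite horner0 eq_sym oner_eq0.
Qed.

Section Lift.
Variables (a : R) (u : X) (f : X -> R).

(** The end point of a path lift along the segment from [u] to [v].  It is a
    relation because the lift exists only where $f \bmod a$ is continuous. *)
Definition lift_value v y := exists theta : R -> R,
  [/\ forall r : R, 0 <= r <= 1 -> theta x @[x --> r] --> theta r,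
      theta 0 = 0, theta 1 = y &
      forall r, 0 <= r <= 1 ->
        exists k : int, theta r - f (segment_pt u v r) = a *~ k].

Lemma lift_value_end v y : lift_value v y -> exists k : int, y - f v = a *~ k.
Proof.
move=> [theta [_ _ <- /(_ 1)]]; rewrite segment_pt1; apply.
by rewrite ler01 lexx.
Qed.

Hypotheses (a0 : 0 < a) (fu : exists k : int, f u = a *~ k).

Lemma lift_value_uniq v y y' : lift_value v y -> lift_value v y' -> y = y'.
Proof.
move=> [th [thc th0 <- thf]] [th' [th'c th'0 <- th'f]].
apply/eqP; rewrite -subr_eq0; apply/eqP.
have -> : 0 = th 0 - th' 0 by rewrite th0 th'0 subrr.
apply: (path_in_lattice (g := fun t => th t - th' t) a0).
  by move=> t t01; apply: cvgB; [exact: thc|exact: th'c].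
move=> t t01; have [k kE] := thf t t01; have [l lE] := th'f t t01.
by exists (k - l); rewrite mulrzBr -kE -lE th0 th'0; ring.
Qed.

Lemma lift_value_base : lift_value u 0.
Proof.
have [k fk] := fu.
exists (fun=> 0); split => //; first by move=> *; exact: cvg_cst.
by move=> r _; exists (- k); rewrite segment_ptvv fk mulrNz sub0r.
Qed.

Hypothesis f_continuous : forall v, affine_orbit u v -> forall e, 0 < e ->
  \forall w \near v, affine_orbit u w -> near_lattice a e (f w - f v).

(** Lifting over the triangle with vertices [u], [v], [w] shows that the lift
    value varies continuously along the edge from [v] to [w]. *)
Lemma lift_value_segment v w : affine_orbit u v -> affine_orbit u w ->
  exists g : R -> R, [/\ forall s : R, 0 <= s <= 1 -> g x @[x --> s] --> g s &
    forall s, 0 <= s <= 1 -> lift_value (segment_pt v w s) (g s)].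
Proof.
move=> uv uw; pose pt (P : R * R) := segment_pt u (segment_pt v w P.2) P.1.
have ptc P : pt Q @[Q --> P] --> pt P.
  apply: segment_pt_cvg; [exact: cvg_cst| |exact: cvg_fst].
  by apply: segment_pt_cvg; [exact: cvg_cst|exact: cvg_cst|exact: cvg_snd].
have upt P : affine_orbit u (pt P).
  apply: affine_orbit_segment; first exact: affine_orbit_id.
  exact: affine_orbit_segment.
have [|theta thP] := @lift_along_rays R a (f \o pt) a0.
  move=> P e e0.
  have near_pt : nbhs P [set Q | affine_orbit u (pt Q) ->
      near_lattice a e (f (pt Q) - f (pt P))].
    exact: ptc (f_continuous (upt P) e0).
  by apply: (filterS _ near_pt) => Q; apply.
exists (fun s => theta (1, s)); split.
  move=> s s01; have [|thc _ _] := thP 1 s _ s01; first by rewrite ler01 lexx.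
  apply: (@cvg_comp _ _ _ (fun x => (1, x)) theta _ (nbhs (1 : R, s))) thc.
  apply: (cvg_pair (G := nbhs (1 : R)) (H := nbhs s)); last exact: cvg_id.
  exact: cvg_cst.
move=> s s01; exists (fun r => theta (r, s)); split => //.
- move=> r r01; have [thc _ _] := thP r s r01 s01.
  apply: (@cvg_comp _ _ _ (fun x => (x, s)) theta _ (nbhs (r, s))) thc.
  apply: (cvg_pair (G := nbhs r) (H := nbhs s)); first exact: cvg_id.
  exact: cvg_cst.
- by have [|_ _ //] := thP 0 s _ s01; rewrite ler01 lexx.
- move=> r r01; have [_ [k ->] _] := thP r s r01 s01.
  have [l fl] := fu; exists (k - l).
  by rewrite /= {2}/pt /= segment_pt0 fl mulrzBr /pt/=; ring.
Qed.

Hypothesis f_map : forall v, affine_orbit u v ->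
  exists k : int, f (T v) - f v - f (T u) = a *~ k.

(** Along the segment from [u] to [v], the lift at $Tz$ and the lift at [z]
    differ by a continuous function whose values are all congruent to $f(Tu)$;
    it is therefore constant, equal to its value [y1] at $z = u$. *)
Lemma lift_value_map v y y1 : affine_orbit u v ->
  lift_value v y -> lift_value (T u) y1 -> lift_value (T v) (y1 + y).
Proof.
move=> uv vy uy1.
have uu := affine_orbit_id u.
have [g [gc gL]] := lift_value_segment uu uv.
have [h [hc hL]] := lift_value_segment (affine_orbit_map uu) (affine_orbit_map uv).
have I0 : 0 <= (0 : R) <= 1 by rewrite lexx ler01.
have I1 : 0 <= (1 : R) <= 1 by rewrite lexx ler01.
have g0 : g 0 = 0.
  apply: lift_value_uniq lift_value_base.
  by rewrite -[u in lift_value u](segment_pt0 u v); exact: gL.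
have g1 : g 1 = y.
  apply: lift_value_uniq vy.
  by rewrite -[v in lift_value v](segment_pt1 u v); exact: gL.
have h0 : h 0 = y1.
  by apply: lift_value_uniq uy1; rewrite -(segment_pt0 (T u) (T v)); exact: hL.
have h1 : lift_value (T v) (h 1).
  by rewrite -{1}(segment_pt1 (T u) (T v)); exact: hL.
have hg t : 0 <= t <= 1 -> exists k : int, h t - g t - f (T u) = a *~ k.
  move=> t01; have [k1 e1] := lift_value_end (hL t t01).
  have [k2 e2] := lift_value_end (gL t t01).
  have [k3 e3] := f_map (affine_orbit_segment t uu uv).
  exists (k1 - k2 + k3); rewrite mulrzDr mulrzBr -e1 -e2 -e3 segment_pt_map; ring.
suff : h 1 - g 1 = h 0 - g 0.
  by rewrite g0 g1 h0 subr0 => /eqP; rewrite subr_eq => /eqP <-.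
apply: (path_in_lattice (g := fun t => h t - g t) a0).
  by move=> t t01; apply: cvgB; [exact: hc|exact: gc].
move=> t t01; have [k kE] := hg t t01; have [l lE] := hg 0 I0.
by exists (k - l); rewrite mulrzBr -kE -lE; ring.
Qed.

Lemma lift_value_iter n y1 : lift_value (T u) y1 ->
  lift_value (iter n T u) (y1 *+ n).
Proof.
move=> uy1; elim: n => [|n IH]; first exact: lift_value_base.
by rewrite mulrS; apply: lift_value_map => //; exact: affine_orbit_iter.
Qed.

(** The lift [y1] of $f(Tu)$ vanishes because the orbit of [u] returns to [u]:
    the lift at $T^n u$ is $n y_1$, yet it is small when $T^n u$ is so close
    to [u] that [f] hardly moves along the segment that joins them. *)
Lemma lift_value_zero y1 : HC T u -> lift_value (T u) y1 -> y1 = 0.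
Proof.
move=> uHC uy1; apply/eqP; rewrite -normr_le0; apply/ler_addgt0Pr => e e0.
rewrite add0r; pose e' := Num.min e (a / 2).
have e'0 : 0 < e' by rewrite lt_min e0 divr_gt0.
have [U Uu UO] := star_shaped_nbhs (f_continuous (affine_orbit_id u) e'0).
have [n On] := HC_nbhs_pos T_continuous uHC Uu.
have [th [thc th0 th1 thf]] := lift_value_iter n.+1 uy1.
have : `|th 1| < e'.
  apply: (path_near_lattice (a := a)) => //; first by rewrite ge_min lexx orbT.
  move=> t t01; have [k kE] := thf t t01; have [l lE] := fu.
  have ut := affine_orbit_segment t (affine_orbit_id u) (affine_orbit_iter u n.+1).
  have fO := UO _ _ On t01 ut.
  have := near_latticeMz (k + l) fO; congr near_lattice.
  by rewrite mulrzDr -kE -lE; ring.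
rewrite th1 normrMn => lt_e.
apply: (@le_trans _ _ (`|y1| *+ n.+1)).
  by rewrite mulrS lerDl mulrn_wge0.
by apply/ltW/(lt_le_trans lt_e); rewrite ge_min lexx.
Qed.

End Lift.
End Winding.

(** * Simultaneous returns of an orbit and of monomial phases *)

Section SimultaneousReturns.
Variables (R : realType) (X : topologicalLmodType R[i]) (T : {linear X -> X}).
Hypothesis T_continuous : continuous T.
Implicit Types (F : set_system nat) (u v w : X) (x y e theta : R).

(** When the limits of [q] at returns of $T^n u$ to [u] fill the circle, any
    limit at [v] can be corrected to 0.  Otherwise they form a lattice $aZ$,
    and the limits define a circle-valued cocycle [f], to which the lifting
    argument applies. *)
Lemma joint_limit_zero F q u v : Filter F -> idempotent F ->
  visits_along T F -> quasi_additive F q -> HC T u ->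
  joint_limit (R := R) T F q u v 0.
Proof.
move=> FF Fidem Fvis qF uHC.
have trans u1 u2 u3 x y : joint_limit T F q u1 u2 x -> joint_limit T F q u2 u3 y ->
  joint_limit T F q u1 u3 (x + y) := joint_limit_trans T_continuous FF Fidem qF.
have ex w z : HC T w -> exists x, joint_limit T F q w z x :=
  joint_limit_exists q FF z Fvis.
pose H := [set x | joint_limit T F q u u x].
have [||||HT|[a a0 HE]] := @closed_periodic_semigroup R H.
- exact: ex.
- by move=> x y; exact: trans.
- by move=> x k; exact: joint_limit_shift.
- move=> x lim; apply: joint_limit_closed => O e Ou e0.
  have [y Hy xy] := lim e e0.
  by exists u, y; split => //; exact: nbhs_singleton.
- have [x uvx] := ex u v uHC.
  by rewrite -[0](addNr x); apply: trans uvx; exact: HT.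
have H0 : H 0 by apply/HE; exists 0; rewrite mulr0z.
have [k1 ak1] : exists k : int, 1 = a *~ k.
  by apply/HE; rewrite -[1]add0r; exact: (joint_limit_shift 1 H0).
have uniq w x y : HC T w -> joint_limit T F q u w x -> joint_limit T F q u w y ->
    exists k : int, x - y = a *~ k.
  move=> wHC uwx uwy; have [z wuz] := ex w u wHC.
  have [k kE] := (HE _).1 (trans _ _ _ _ _ uwx wuz).
  have [l lE] := (HE _).1 (trans _ _ _ _ _ uwy wuz).
  by exists (k - l); rewrite mulrzBr -kE -lE; ring.
pose f w := xget 0 [set x | joint_limit T F q u w x].
have fP w : joint_limit T F q u w (f w).
  by rewrite /f; case: xgetP => [x -> //|]; have [x uwx] := ex u w uHC => /(_ x).
have aHC w : affine_orbit T u w -> HC T w := HC_affine_orbit T_continuous uHC.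
have fu : exists k : int, f u = a *~ k by apply/HE/fP.
have f_cont w : affine_orbit T u w -> forall e, 0 < e ->
    \forall z \near w, affine_orbit T u z -> near_lattice a e (f z - f w).
  move=> uw e e0.
  have wuniq x : joint_limit T F q u w x -> exists k : int, x - f w = a *~ k.
    by move=> uwx; apply: uniq (aHC w uw) uwx (fP w).
  have := joint_limit_continuous (ex_intro _ k1 ak1) wuniq e0.
  by apply: filterS => z zP _; exact: zP.
have f_map w : affine_orbit T u w ->
    exists k : int, f (T w) - f w - f (T u) = a *~ k.
  move=> uw.
  have Tw := trans _ _ _ _ _ (fP (T u)) (joint_limit_map T_continuous (fP w)).
  have [k kE] := uniq _ _ _ (HC_map T_continuous (aHC w uw)) (fP (T w)) Tw.
  by exists k; rewrite -kE; ring.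
have uTu := affine_orbit_map (affine_orbit_id T u).
have [y1 Ly1] : exists y, lift_value a u f (T u) y.
  have [g [_ gL]] := lift_value_segment a0 fu f_cont uTu uTu.
  exists (g 0); have := gL 0; rewrite segment_ptvv; apply.
  by rewrite lexx ler01.
have y10 := lift_value_zero T_continuous a0 fu f_cont f_map uHC Ly1.
rewrite y10 in Ly1.
have orbit0 n : joint_limit T F q u (iter n T u) 0.
  have := lift_value_iter a0 fu f_cont f_map n Ly1; rewrite mul0rn => Ln.
  have [k kE] := lift_value_end Ln.
  rewrite -[0](addNr (f (iter n T u))); apply: trans (fP _).
  by apply/HE; exists k; rewrite -kE sub0r.
apply: joint_limit_closed => O e Ov e0; have [n On] := HC_nbhs uHC Ov.
by exists (iter n T u), 0; rewrite subrr normr0.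
Qed.

Definition adjoin_phase F (q : nat -> R) : set_system nat :=
  filter_from [set Ae : set nat * R | F Ae.1 /\ 0 < Ae.2]
    (fun Ae => [set n | Ae.1 n /\ near_lattice 1 Ae.2 (q n)]).

Lemma adjoin_phase_filter F q : Filter F -> Filter (adjoin_phase F q).
Proof.
move=> FF; apply: filter_from_filter.
  by exists (setT, 1); split => //=; exact: filterT.
move=> [A e] [B e'] [/= FA e0] [/= FB e'0].
exists (A `&` B, Num.min e e'); first by split; [exact: filterI|rewrite lt_min e0].
move=> n [[An Bn] qn]; split; split => //; apply: near_lattice_le qn;
  by rewrite ge_min lexx ?orbT.
Qed.

Lemma sub_adjoin_phase F q A : F A -> adjoin_phase F q A.
Proof. by move=> FA; exists (A, 1) => // n []. Qed.

Lemma adjoin_phase_near F q e : Filter F -> 0 < e ->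
  adjoin_phase F q [set n | near_lattice 1 e (q n)].
Proof.
by move=> FF e0; exists (setT, e) => [|n []//]; split => //; exact: filterT.
Qed.

Lemma adjoin_phase_idempotent F q : Filter F -> idempotent F ->
  quasi_additive F q -> idempotent (adjoin_phase F q).
Proof.
move=> FF Fidem qF C [[A e] [/= FA e0] AC].
have e20 : 0 < e / 2 by rewrite divr_gt0.
have e40 : 0 < e / 4 by rewrite divr_gt0.
have [B FB AB] := Fidem A FA.
exists [set n | B n /\ near_lattice 1 (e / 2) (q n)]; first by exists (B, e / 2).
move=> m [Bm qm].
exists ([set n | A (n + m)%N] `&`
    [set n | near_lattice 1 (e / 4) (q (n + m)%N - q n - q m)], e / 4).
  by split => //=; apply: filterI; [exact: AB|exact: qF].
move=> n [[Anm qnm] qn]; apply: AC; split => //.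
have := near_latticeD qnm (near_latticeD qn qm).
rewrite (_ : e / 4 + (e / 4 + e / 2) = e); last by field.
by congr near_lattice; ring.
Qed.

Lemma adjoin_phase_visits_along F q : Filter F -> idempotent F -> visits_along T F ->
  quasi_additive F q -> visits_along T (adjoin_phase F q).
Proof.
move=> FF Fidem Fvis qF u v O C uHC Ov [[A e] [/= FA e0] AC].
have [n [An On qn]] := joint_limit_zero FF Fidem Fvis qF uHC Ov FA e0.
by exists n => //; apply: AC; rewrite subr0 in qn.
Qed.

(** Positive times are recorded because the orbit in the theorem starts
    at $n = 1$. *)
Definition return_filter F := [/\ Filter F, idempotent F, visits_along T F &
  F [set n | (0 < n)%N]].

Lemma adjoin_phase_return_filter F q : return_filter F -> quasi_additive F q ->
  return_filter (adjoin_phase F q).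
Proof.
move=> [FF Fidem Fvis Fpos] qF; split.
- exact: adjoin_phase_filter.
- exact: adjoin_phase_idempotent.
- exact: adjoin_phase_visits_along.
- exact: sub_adjoin_phase.
Qed.

Lemma positive_return_filter : return_filter (globally [set n | (0 < n)%N]).
Proof.
split => //; first exact: globally_filter.
  move=> A posA; exists [set n | (0 < n)%N] => // m m0 n /= n0.
  by apply: posA; rewrite /= addn_gt0 n0.
move=> u v O A uHC Ov posA; have [n On] := HC_nbhs_pos T_continuous uHC Ov.
by exists n.+1 => //; exact: posA.
Qed.

Lemma near_lattice_sum F (I : Type) (s : seq I) (c : I -> nat) (p : I -> nat -> R) :
    Filter F ->
    (forall i e, 0 < e -> F [set n | near_lattice 1 e (p i n)]) ->
  forall e, 0 < e ->
    F [set n | near_lattice 1 e (\sum_(i <- s) p i n *+ c i)].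
Proof.
move=> FF pF; elim: s => [|i s IH] e e0.
  apply: nearW => n; rewrite /= big_nil.
  by apply: near_lattice_small; rewrite normr0.
have e20 : 0 < e / 2 by rewrite divr_gt0.
have ec0 : 0 < e / 2 / (c i).+1%:R by rewrite divr_gt0.
apply: (filterS _ (filterI (pF i _ ec0) (IH _ e20))) => n [pn sn] /=.
rewrite big_cons [e]splitr; apply: near_latticeD sn.
have := near_lattice_mulrn (c i) ec0 pn.
by rewrite -[_ *+ (c i).+1]mulr_natr divfK// pnatr_eq0.
Qed.

(** The middle terms of the binomial expansion of $\theta (n + m)^{k+1}$ are
    integer multiples of the lower monomials $\theta n^j$. *)
Lemma monomial_quasi_additive F theta k : Filter F ->
    (forall j e, (0 < j <= k)%N -> 0 < e ->
      F [set n | near_lattice 1 e (theta * n%:R ^+ j)]) ->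
  quasi_additive F (fun n => theta * n%:R ^+ k.+1).
Proof.
move=> FF lowF m e e0.
have lowF' (j : 'I_k) e' : 0 < e' ->
    F [set n | near_lattice 1 e' (theta * n%:R ^+ j.+1)].
  by move=> e'0; apply: lowF; rewrite ?ltn_ord.
have := near_lattice_sum (index_enum 'I_k)
  (fun j => (m ^ (k - j) * 'C(k.+1, j.+1))%N) FF lowF' e0.
apply: filterS => n /=; congr near_lattice.
rewrite (addnC n m) natrD exprDn big_ord_recl big_ord_recr/= bin0 /bump/= add1n binn.
rewrite !mulr1n subnn subn0 !expr0 mulr1 mul1r !mulrDr mulr_sumr.
have -> : forall x y z : R, x + (y + z) - z - x = y by move=> *; ring.
apply: eq_bigr => j _; rewrite /bump/= add1n subSS.
rewrite -[LHS]mulr_natr natrM natrX -[X in _ = theta * X]mulr_natr; ring.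
Qed.

Lemma adjoin_monomials F theta D : return_filter F ->
  exists F', [/\ return_filter F', forall A, F A -> F' A &
    forall k e, (0 < k <= D)%N -> 0 < e ->
      F' [set n | near_lattice 1 e (theta * n%:R ^+ k)]].
Proof.
move=> retF; elim: D => [|D [F' [retF' FF' monF']]].
  by exists F; split => // -[].
have [fF' _ _ _] := retF'.
pose q n := theta * n%:R ^+ D.+1.
exists (adjoin_phase F' q); split.
- apply: adjoin_phase_return_filter => //; exact: monomial_quasi_additive.
- by move=> A FA; apply: sub_adjoin_phase; exact: FF'.
- move=> k e /andP[k0]; rewrite leq_eqVlt => /orP[/eqP-> e0|kD e0].
    exact: adjoin_phase_near.
  by apply: sub_adjoin_phase; apply: monF' => //; rewrite k0.
Qed.

Lemma monomials_return_filter (thetas : seq R) D :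
  exists2 F, return_filter F & forall theta k e, theta \in thetas ->
    (0 < k <= D)%N -> 0 < e -> F [set n | near_lattice 1 e (theta * n%:R ^+ k)].
Proof.
elim: thetas => [|theta s [F retF sF]].
  by exists (globally [set n | (0 < n)%N]) => //; exact: positive_return_filter.
have [F' [retF' FF' monF']] := adjoin_monomials theta D retF.
exists F' => // th k e; rewrite inE => /orP[/eqP->|ths] kD e0; first exact: monF'.
by apply: FF'; exact: sF.
Qed.

End SimultaneousReturns.

(** * Bogolyubov's theorem for dense sets of integers *)

Section Bogolyubov.
Variable R : realType.
Implicit Types (x y e theta : R) (N M m r a b : nat) (k : int).

(** The sum telescopes after multiplication by $2 \sin(\pi n/M)$. *)
Lemma sum_cos_eq0 M n : (0 < n < M)%N ->
  \sum_(xi < M) cos (n%:R * ((pi *+ 2 / M%:R) * xi%:R)) = 0 :> R.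
Proof.
move=> /andP[n0 nM].
have M0n : (0 < M)%N by exact: leq_trans nM.
have M0 : 0 < M%:R :> R by rewrite ltr0n.
pose h : R := n%:R * pi / M%:R.
have sinh : 0 < sin h.
  apply: sin_gt0_pi; rewrite /h divr_gt0 ?mulr_gt0 ?pi_gt0 ?ltr0n//=.
  by rewrite ltr_pdivrMr// mulrC ltr_pM2l ?pi_gt0// ltr_nat.
suff : (sin h *+ 2) * \sum_(xi < M) cos (n%:R * ((pi *+ 2 / M%:R) * xi%:R)) = 0.
  by move=> /eqP; rewrite mulf_eq0 mulrn_eq0/= (gt_eqF sinh)/= => /eqP.
have tele m : (sin h *+ 2) * \sum_(xi < m) cos (n%:R * ((pi *+ 2 / M%:R) * xi%:R))
    = sin (h *+ 2 * m%:R - h) + sin h.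
  elim: m => [|m IH]; first by rewrite big_ord0 !mulr0 sub0r sinN addNr.
  rewrite big_ord_recr/= mulrDr IH.
  have -> : n%:R * (pi *+ 2 / M%:R * m%:R) = h *+ 2 * m%:R :> R.
    by rewrite /h; field; rewrite gt_eqF.
  have -> : h *+ 2 * m.+1%:R - h = h *+ 2 * m%:R + h by rewrite -natr1; ring.
  rewrite sinB sinD; ring.
rewrite tele.
have -> : h *+ 2 * M%:R - h = - h + (pi *+ 2) *+ n.
  by rewrite -[_ *+ n]mulr_natr /h; field; rewrite gt_eqF.
by rewrite (periodicn (@sinD2pi R)) sinN addNr.
Qed.

Lemma sum_cosz_eq0 M k : k != 0 -> (`|k| < M)%N ->
  \sum_(xi < M) cos (k%:~R * ((pi *+ 2 / M%:R) * xi%:R)) = 0 :> R.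
Proof.
move=> k0 kM; rewrite -[RHS](@sum_cos_eq0 M `|k|) ?absz_gt0 ?k0//.
apply: eq_bigr => xi _; case: k {k0 kM} => n //.
by rewrite NegzE abszN/= mulrNz mulNr cosN.
Qed.

Lemma cos_near_lattice_ge0 x : near_lattice 1 4^-1 x -> 0 <= cos (pi *+ 2 * x).
Proof.
move=> [k xk].
have -> : cos (pi *+ 2 * x) = cos (pi *+ 2 * (x - k%:~R)).
  have per n y : cos (y + pi *+ 2 * n%:R) = cos y.
    by rewrite mulr_natr (periodicn (@cosD2pi R)).
  case: k {xk} => n.
    by rewrite -[in RHS](per n); congr cos; rewrite -pmulrn; ring.
  by rewrite -[in LHS](per n.+1); congr cos; rewrite NegzE mulrNz -pmulrn; ring.
have := @pi_gt0 R; move: xk; rewrite ltr_norml => /andP[x1 x2] pi0.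
by apply: cos_ge0_pihalf; apply/andP; split; nra.
Qed.

Lemma cos3E x y z : cos x * cos y * cos z =
  (cos (x + y + z) + cos (x + y - z) + cos (x - y + z) + cos (x - y - z)) / 4 :> R.
Proof. by rewrite !(cosB, sinB, cosD, sinD); field. Qed.

Section FiniteFourier.
Variables (S : seq nat) (N m : nat).
Hypotheses (S_uniq : uniq S) (S_lt : forall a, a \in S -> (a < N)%N).
Hypotheses (N_gt0 : (0 < N)%N) (S_dense : (N <= m * size S)%N).

(* The modulus exceeds every $|r + c + d - a - b|$ with entries below [N],
   which is less than $3N$; no wrap-around occurs in $Z/MZ$. *)
Let M := (4 * N)%N.
Let w : R := pi *+ 2 / M%:R.
Let D := [seq (a, b) | a <- S, b <- S].

(** [power_spectrum xi] is $|\sum_{a \in S} \exp(2 i \pi a \xi / M)|^2$. *)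
Definition power_spectrum (xi : nat) : R :=
  \sum_(z <- D) cos ((z.1%:Z - z.2%:Z)%:~R * (w * xi%:R)).

Lemma power_spectrum_ge0 xi : 0 <= power_spectrum xi.
Proof.
rewrite /power_spectrum big_allpairs_dep/=.
have -> : \sum_(a <- S) \sum_(b <- S) cos ((a%:Z - b%:Z)%:~R * (w * xi%:R)) =
    (\sum_(a <- S) cos (a%:R * (w * xi%:R))) ^+ 2 +
    (\sum_(a <- S) sin (a%:R * (w * xi%:R))) ^+ 2.
  rewrite !expr2 !big_distrl -big_split; apply: eq_bigr => a _ /=.
  rewrite !big_distrr -big_split; apply: eq_bigr => b _ /=.
  by rewrite rmorphB/= mulrBl cosB !pmulrn.
by rewrite addr_ge0// sqr_ge0.
Qed.

Lemma power_spectrum0 : power_spectrum 0 = (size S)%:R ^+ 2.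
Proof.
rewrite /power_spectrum.
under eq_bigr do rewrite !mulr0 cos0.
by rewrite big_const_seq count_predT iter_addr_0 size_allpairs natrM expr2.
Qed.

Lemma sum_power_spectrum : \sum_(xi < M) power_spectrum xi = M%:R * (size S)%:R.
Proof.
rewrite exchange_big/= big_allpairs_dep/=.
have inner a : a \in S ->
    \sum_(b <- S) \sum_(xi < M) cos ((a%:Z - b%:Z)%:~R * (w * xi%:R)) = M%:R :> R.
  move=> aS; rewrite (bigD1_seq a)//= [X in _ + X]big_seq_cond.
  rewrite [X in _ + X]big1 => [|b /andP[bS ba]].

    rewrite addr0 subrr; under eq_bigr do rewrite mul0r cos0.
    by rewrite sumr_const card_ord.
  have := S_lt aS; have := S_lt bS => bN aN.
  apply: sum_cosz_eq0; last by rewrite /M; lia.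
  by rewrite subr_eq0 eqz_nat eq_sym.
rewrite big_seq (eq_bigr (fun=> M%:R)) => [|a aS]; last exact: inner.
by rewrite -big_seq big_const_seq count_predT iter_addr_0 mulr_natr.
Qed.

(** Expanding the square, the sum is a combination of full sums of cosines at
    the integer frequencies $(a - b) \pm (c - d) \pm r$, none of which
    vanishes. *)
Lemma sum_spectrum_cos_eq0 r : (r < N)%N ->
    (forall a b c d, a \in S -> b \in S -> c \in S -> d \in S ->
      (r + c + d != a + b)%N) ->
  \sum_(xi < M) power_spectrum xi ^+ 2 * cos (r%:R * (w * xi%:R)) = 0.
Proof.
move=> rN nosol.
under eq_bigr => xi _.
  rewrite expr2 /power_spectrum big_distrl/= big_distrl/=.
  under eq_bigr => z _.
    rewrite big_distrr/= big_distrl/=.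
    under eq_bigr => z' _ do rewrite cos3E.
    over.
  over.
rewrite exchange_big big_seq big1//= => -[a b] /allpairsP[[a' b'] [/= aS bS [-> ->]]].
rewrite exchange_big big_seq big1//= => -[c d] /allpairsP[[c' d'] [/= cS dS [-> ->]]].
rewrite -mulr_suml.
have := (S_lt aS, S_lt bS, S_lt cS, S_lt dS) => -[[[aN bN] cN] dN].
have zero k (F : 'I_M -> R) : k != 0 -> (`|k| < M)%N ->
    (forall xi, F xi = k%:~R * (w * xi%:R)) -> \sum_(xi < M) cos (F xi) = 0.
  by move=> k0 kM FE; under eq_bigr do rewrite FE; exact: sum_cosz_eq0.
have sum4 (s1 s2 s3 s4 : R) : s1 = 0 -> s2 = 0 -> s3 = 0 -> s4 = 0 ->
  (s1 + s2 + s3 + s4) / 4 = 0 by move=> -> -> -> ->; rewrite !addr0 mul0r.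
rewrite !big_split/=; apply: sum4.
- apply: (zero (a'%:Z - b'%:Z + (c'%:Z - d'%:Z) + r%:Z)).
  + by have := nosol _ _ _ _ bS dS aS cS; lia.
  + by rewrite /M; lia.
  + by move=> xi; rewrite !rmorphD !rmorphN/= !pmulrn; ring.
- apply: (zero (a'%:Z - b'%:Z + (c'%:Z - d'%:Z) - r%:Z)).
  + by have := nosol _ _ _ _ aS cS bS dS; lia.
  + by rewrite /M; lia.
  + by move=> xi; rewrite !rmorphD !rmorphN/= !pmulrn; ring.
- apply: (zero (a'%:Z - b'%:Z - (c'%:Z - d'%:Z) + r%:Z)).
  + by have := nosol _ _ _ _ bS cS aS dS; lia.
  + by rewrite /M; lia.
  + by move=> xi; rewrite !rmorphD !rmorphN !rmorphD !rmorphN/= !pmulrn; ring.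
- apply: (zero (a'%:Z - b'%:Z - (c'%:Z - d'%:Z) - r%:Z)).
  + by have := nosol _ _ _ _ aS dS bS cS; lia.
  + by rewrite /M; lia.
  + by move=> xi; rewrite !rmorphD !rmorphN !rmorphD !rmorphN/= !pmulrn; ring.
Qed.

(** Let [thetas] be the frequencies at which the power spectrum is at least
    $|S|^2/8m$; by Parseval's identity they are few.  If no solution existed,
    the weighted sum of [sum_spectrum_cos_eq0] would vanish.  However, the
    frequency 0 contributes $|S|^4$, the other frequencies of [thetas] contribute
    nonnegatively since their cosines are nonnegative, and the remaining ones
    contribute at most $|S|^4/2$ in absolute value, again by Parseval. *)
Lemma bogolyubov_finite : exists thetas : seq R,
  [/\ (size thetas <= 32 * m ^ 2)%N, {in thetas, forall theta, 0 <= theta <= 1} &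
   forall r, (r < N)%N ->
     {in thetas, forall theta, near_lattice 1 4^-1 (theta * r%:R)} ->
     exists a b c d, [/\ a \in S, b \in S, c \in S, d \in S &
       (r + c + d = a + b)%N]].
Proof.
pose s : R := (size S)%:R.
have [m0 s0] : (0 < m)%N /\ (0 < size S)%N.
  by apply/andP; rewrite -muln_gt0 (leq_trans N_gt0).
have s0R : 0 < s by rewrite ltr0n.
have m0R : 0 < m%:R :> R by rewrite ltr0n.
have M0R : 0 < M%:R :> R by rewrite ltr0n /M; lia.
have MsR : M%:R <= 4 * m%:R * s.
  by rewrite /M /s -!natrM ler_nat; move: S_dense; lia.
pose eta : R := (8 * m%:R)^-1.
have eta0 : 0 < eta by rewrite invr_gt0 mulr_gt0.
have etam : eta * m%:R = 8^-1 by rewrite /eta; field; rewrite gt_eqF.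
pose L := [set xi : 'I_M | eta * s ^+ 2 <= power_spectrum xi].
exists [seq xi%:R / M%:R | xi : 'I_M in L]; split.
- rewrite size_map -cardE -(ler_nat R).
  have : #|L|%:R * (eta * s ^+ 2) <= M%:R * s.
    rewrite -sum_power_spectrum (bigID (fun xi : 'I_M => xi \in L))/=.
    rewrite -[X in X <= _]addr0.
    apply: lerD; last by apply: sumr_ge0 => xi _; exact: power_spectrum_ge0.
    rewrite mulr_natl -sumr_const; apply: ler_sum => xi.
    by rewrite inE.
  move=> Lle; have : #|L|%:R * (eta * s ^+ 2) <= 4 * m%:R * s * s.
    by apply: le_trans Lle _; rewrite ler_pM2r.
  rewrite expr2 !mulrA !ler_pM2r// -(ler_pM2r m0R) -mulrA etam natrM natrX => le8.
  have := le8; rewrite ler_pdivrMr//; nra.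
- move=> _ /mapP[xi _ ->]; rewrite divr_ge0//= ler_pdivrMr// mul1r ler_nat.
  exact: ltnW.
move=> r rN near_r; apply: contrapT => nosol.
have sum0 := sum_spectrum_cos_eq0 rN.
have {}sum0 : \sum_(xi < M) power_spectrum xi ^+ 2 * cos (r%:R * (w * xi%:R)) = 0.
  apply: sum0 => a b c d aS bS cS dS; apply/eqP => eq.
  by apply: nosol; exists a, b, c, d.
have M0 : (0 < M)%N by rewrite -(ltr0n R).
have term_ge (xi : 'I_M) :
    (xi == Ordinal M0)%:R * s ^+ 4 - eta * s ^+ 2 * power_spectrum xi <=
    power_spectrum xi ^+ 2 * cos (r%:R * (w * xi%:R)).
  have P0 := power_spectrum_ge0 xi.
  have eP0 : 0 <= eta * s ^+ 2 * power_spectrum xi.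
    by rewrite mulr_ge0// mulr_ge0 ?exprn_ge0// ltW.
  have [->|xi0] := eqVneq xi (Ordinal M0).
    rewrite /= mulr0n !mulr0 cos0 mulr1 mul1r power_spectrum0 -exprM.
    by rewrite lerBlDr lerDl mulr_ge0 ?exprn_ge0// mulr_ge0 ?exprn_ge0// ltW.
  rewrite mul0r sub0r; have [xiL|] := boolP (xi \in L).
    apply: (@le_trans _ _ 0); first by rewrite oppr_le0.
    apply: mulr_ge0; first exact: sqr_ge0.
    have -> : r%:R * (w * xi%:R) = pi *+ 2 * (xi%:R / M%:R * r%:R).
      by rewrite /w; field; rewrite gt_eqF.
    by apply/cos_near_lattice_ge0/near_r/mapP; exists xi; rewrite ?mem_enum.
  move=> xiL; have small : power_spectrum xi < eta * s ^+ 2.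
    by rewrite ltNge; apply: contra xiL => big; rewrite /L inE.
  apply: (@le_trans _ _ (- (power_spectrum xi ^+ 2))).
    by rewrite lerN2 expr2 ler_wpM2r// ltW.
  rewrite -mulrN1; apply: ler_wpM2l; [exact: sqr_ge0|exact: cos_geN1].
have : \sum_(xi < M) ((xi == Ordinal M0)%:R * s ^+ 4 -
    eta * s ^+ 2 * power_spectrum xi) <= 0.
  by rewrite -[X in _ <= X]sum0; apply: ler_sum => xi _; exact: term_ge.
rewrite sumrB -mulr_suml -mulr_sumr sum_power_spectrum.
rewrite (bigD1 (Ordinal M0))// eqxx big1; last by move=> xi /negbTE ->.
rewrite /= addr0 mul1r => le0.
have : s ^+ 4 <= eta * (4 * m%:R) * s ^+ 4.
  move: le0; rewrite subr_le0 => /le_trans; apply.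
  have -> : eta * (4 * m%:R) * s ^+ 4 = eta * s ^+ 2 * (4 * m%:R * s * s) by ring.
  rewrite ler_wpM2l//; first by rewrite mulr_ge0 ?exprn_ge0// ltW.
  by rewrite ler_wpM2r// ltW.
have -> : eta * (4 * m%:R) = 2^-1 by rewrite mulrCA etam; field.
have : 0 < s ^+ 4 by rewrite exprn_gt0.
lra.
Qed.

End FiniteFourier.
End Bogolyubov.

(** * Bohr sets in compact groups *)

Section CompactGroups.
Variables (R : realType) (G : topologicalZmodType).
Hypothesis G_compact : compact [set: G].

Lemma nbhs0_sub (V : set G) : nbhs 0 V ->
  exists2 W, nbhs 0 W & forall x y, W x -> W y -> V (x - y).
Proof.
move=> V0.
have sub00 : z.1 - z.2 @[z --> (0 : G, 0 : G)] --> (0 : G) - 0 :=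
  @sub_continuous G (0, 0).
rewrite subr0 in sub00; have [[A B] /= [A0 B0] AB] := sub00 V V0.
exists (A `&` B); first exact: filterI.
by move=> x y [Ax _] [_ By]; apply: (AB (x, y)).
Qed.

Lemma nbhs0_add (V : set G) : nbhs 0 V ->
  exists2 W, nbhs 0 W & forall x y, W x -> W y -> V (x + y).
Proof.
move=> V0.
have add00 : z.1 + z.2 @[z --> (0 : G, 0 : G)] --> (0 : G) + 0 :=
  @add_continuous G (0, 0).
rewrite addr0 in add00; have [[A B] /= [A0 B0] AB] := add00 V V0.
exists (A `&` B); first exact: filterI.
by move=> x y [Ax _] [_ By]; apply: (AB (x, y)).
Qed.

Lemma finitely_many_translates (W : set G) : nbhs 0 W ->
  exists s : seq G, forall x, exists2 y, y \in s & W (x - y).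
Proof.
move=> W0.
(* Finite subsets ordered by inclusion. *)
pose F : set_system (seq G) :=
  filter_from [set: seq G] (fun s0 => [set s : seq G | {subset s0 <= s}]).
have FF : Filter F.
  apply: filter_from_filter; first by exists [::].
  move=> s1 s2 _ _; exists (s1 ++ s2) => // s ss.
  by split => x xs; apply: ss; rewrite mem_cat xs ?orbT.
have [] := (compact_near_coveringP _).1 G_compact _ F
  (fun s x => exists2 y, y \in s & W (x - y)) FF.
  move=> x _.
  have subx : z - x @[z --> x] --> x - x.
    have sxx : z.1 - z.2 @[z --> (x, x)] --> x - x := @sub_continuous G (x, x).
    apply: (@cvg_comp _ _ _ (fun z => (z, x)) (fun z : G * G => z.1 - z.2)
      _ (nbhs (x, x))) sxx.
    exact: (cvg_pair (G := nbhs x) (H := nbhs x) cvg_id (cvg_cst _)).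
  rewrite subrr in subx.
  exists ([set z | W (z - x)], [set s : seq G | x \in s]); first split => /=.
  - exact: subx W0.
  - by exists [:: x] => // s; apply; rewrite inE.
  - by move=> [z s] [/= Wz xs]; exists x.
by move=> s _ /(_ s (fun _ xs => xs)) sP; exists s => x; exact: sP.
Qed.

Lemma pigeonhole_density (Y : Type) (s : seq Y) (t : seq nat) (P : Y -> pred nat) :
  (forall n, n \in t -> has (P^~ n) s) ->
  (size t <= \sum_(y <- s) count (P y) t)%N.
Proof.
elim: t => [//|n t IH] tP /=.
rewrite big_split/= -add1n leq_add//.
  2: by apply: IH => k kt; apply: tP; rewrite inE kt orbT.
have := tP n (mem_head _ _); rewrite has_count -sum1_count big_mkcond/=.
by move=> /leq_trans; apply; apply: leq_sum => y _; case: (P y n).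
Qed.

(** Bogolyubov's theorem replaces characters of [G].  Some translate $y + W$
    contains $n g$ for a positive proportion of the $n < N$; the combinations
    $a + b - c - d$ of such [n] cover the part below [N] of a Bohr set, whose
    frequencies have a cluster point as [N] grows because their number stays
    bounded. *)
Lemma bohr_set_in_return_times (V : set G) (g : G) : nbhs 0 V ->
  exists thetas : seq R, forall r : nat,
    {in thetas, forall theta, near_lattice 1 8^-1 (theta * r%:R)} -> V (g *+ r).
Proof.
move=> V0.
have [A A0 VA] := nbhs0_sub V0; have [W W0 AW] := nbhs0_add A0.
have [s sP] := finitely_many_translates W0.
pose m := size s; pose K := (32 * m ^ 2)%N.
have window N : exists h : 'rV[R]_K, (forall i, `[0, 1]%classic (h ord0 i)) /\
    forall r, (r < N)%N ->
      (forall i, near_lattice 1 4^-1 (h ord0 i * r%:R)) -> V (g *+ r).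
  have [->|N0] := posnP N.
    by exists 0; split => // i; rewrite mxE /= in_itv/= lexx ler01.
  pose P (y : G) (n : nat) := `[< W (g *+ n - y) >].
  have [y ys yN] : exists2 y, y \in s & (N <= m * count (P y) (iota 0 N))%N.
    apply: contrapT => no.
    have lt_N y : y \in s -> (m * count (P y) (iota 0 N) <= N.-1)%N.
      move=> ys; rewrite -ltnS prednK// ltnNge; apply/negP => Ny.
      by apply: no; exists y.
    have m0 : (0 < m)%N by have [y] := sP 0; rewrite /m; case: (s).
    have cover : (N <= \sum_(y <- s) count (P y) (iota 0 N))%N.
      rewrite -{1}(size_iota 0 N); apply: pigeonhole_density => n _.
      by have [y ys Wy] := sP (g *+ n); apply/hasP; exists y => //; exact/asboolP.
    have : (m * N <= m * N.-1)%N.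
      apply: (@leq_trans (m * \sum_(y <- s) count (P y) (iota 0 N))).
        by rewrite leq_mul2l cover orbT.
      rewrite big_distrr/= big_seq.
      apply: (@leq_trans (\sum_(y <- s | y \in s) N.-1)); first exact: leq_sum.
      by rewrite -big_seq big_const_seq count_predT iter_addn_0 mulnC.
    by rewrite leq_pmul2l// leqNgt ltn_predL N0.
  pose S := [seq n <- iota 0 N | P y n].
  have SN n : n \in S -> (n < N)%N by rewrite mem_filter mem_iota => /andP[].
  have Suniq : uniq S by rewrite filter_uniq// iota_uniq.
  have Sdense : (N <= m * size S)%N by rewrite size_filter.
  have [th [th_size th01 thP]] := bogolyubov_finite R Suniq SN N0 Sdense.
  exists (\row_i nth 0 th i); split.
    move=> i; rewrite mxE /= in_itv/=.
    have [ith|thi] := ltnP i (size th); first exact/th01/mem_nth.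
    by rewrite nth_default// lexx ler01.
  move=> r rN near_r.
  have [|a [b [c [d [aS bS cS dS rcd]]]]] := thP r rN.
    move=> x /(nthP 0)[i ith <-].
    have iK : (i < K)%N by exact: leq_trans th_size.
    by have := near_r (Ordinal iK); rewrite mxE.
  have WS n : n \in S -> W (g *+ n - y).
    by rewrite mem_filter => /andP[/asboolP].
  (* The translation by [y] cancels in the difference. *)
  have -> : g *+ r = (g *+ a - y + (g *+ b - y)) - (g *+ c - y + (g *+ d - y)).
    rewrite -[LHS](addrK (g *+ c + g *+ d)) -!mulrnDr addnA rcd !mulrnDr.
    by rewrite !(addrACA _ (- y)) [X in _ = _ + X]opprD [RHS]addrACA subrr addr0.
  by apply: VA; apply: AW; exact: WS.
have [h hP] := choice window.
have [|th [_ thcl]] := @rV_compact R K (fun=> `[0, 1]%classic)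
    (fun=> segment_compact (R := R) (a := 0) (b := 1)) (h @ \oo) _.
  by exists 0%N => // N _; have [] := hP N.
exists [seq th ord0 i | i : 'I_K] => r near_r.
(* The tolerance at the limit is half of that in a window, and the radius makes
   the phases at time [r] differ by less than 1/8. *)
pose B := [set v : 'rV[R]_K | forall i, `|th ord0 i - v ord0 i| < (8 * r.+1%:R)^-1].
have Bth : nbhs th B.
  exists (fun _ j => ball (th ord0 j) (8 * r.+1%:R)^-1) => [i j|v vP i].
    by rewrite (ord1 i); apply: nbhsx_ballx; rewrite invr_gt0 mulr_gt0.
  exact: vP ord0 i.
have [|_ [[N /= rN <-] hB]] := thcl (h @` [set N | (r < N)%N]) B _ Bth.
  by exists r.+1 => // N /= rN; exists N.
have [_] := hP N; apply => // i.
have near_th : near_lattice 1 8^-1 (th ord0 i * r%:R).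
  by apply: near_r; apply/mapP; exists i; rewrite ?mem_enum.
have small : near_lattice 1 8^-1 ((h N ord0 i - th ord0 i) * r%:R).
  apply: near_lattice_small; rewrite normrM distrC (ger0_norm (x := r%:R))//.
  apply: (@le_lt_trans _ _ ((8 * r.+1%:R)^-1 * r%:R)).
    by rewrite ler_wpM2r// ltW//; exact: hB.
  rewrite invfM -mulrA gtr_pMr ?invr_gt0// mulrC ltr_pdivrMr// mul1r ltr_nat//.
have := near_latticeD near_th small.
rewrite (_ : 8^-1 + 8^-1 = 4^-1); last by field.
by congr near_lattice; ring.
Qed.

End CompactGroups.

(** * Returns with polynomial phases *)

Lemma filter_forall_mem (I : eqType) (Y : Type) (F : set_system Y) (s : seq I)
    (A : I -> set Y) : Filter F -> (forall i, i \in s -> F (A i)) ->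
  F [set y | forall i, i \in s -> A i y].
Proof.
move=> FF; elim: s => [|i s IH] sF.
  by apply: nearW => y i; rewrite in_nil.
have Fs : F [set y | forall j, j \in s -> A j y].
  by apply: IH => j js; apply: sF; rewrite inE js orbT.
apply: (filterS _ (filterI (sF i (mem_head _ _)) Fs)) => y [Ai As] j.
by rewrite inE => /orP[/eqP->//|]; exact: As.
Qed.

Theorem theorem2p2 (R : realType) (X : topologicalLmodType R[i])
  (T : {linear X -> X}) (T_continuous : continuous T)
  (T_hypercyclic : hypercyclic T)
  (G : topologicalZmodType) (G_compact : compact [set: G])
  (p : nat) (p_ge1 : (1 <= p)%N) (g : 'I_p -> G)
  (d : 'I_p -> nat) (d_ge1 : forall j, (1 <= d j)%N) :
  forall u v : X, HC T u -> Fset T g d u v 0.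
Proof.
move=> u v uHC B [[U W] /= [Uv [P rowP PW]] UWB].
have P0 i : nbhs 0 (P ord0 i).
  by have := rowP ord0 i; rewrite mxE; case: ifP.
have [Th ThP] := choice (fun i : 'I_(\sum_j d j) =>
  bohr_set_in_return_times R G_compact (g (tagnat.sig1 i)) (P0 i)).
have [F [FF _ Fvis Fpos] Fmon] := monomials_return_filter T_continuous
  (flatten [seq Th i | i : 'I_(\sum_j d j)]) (\max_j d j).
have Fentry i : F [set n | P ord0 i (phases g d n ord0 i)].
  have e_bounds : (0 < d (tagnat.sig1 i) - tagnat.sig2 i <= \max_j d j)%N.
    rewrite subn_gt0 ltn_ord (leq_trans (leq_subr _ _))//.
    exact: (leq_bigmax (tagnat.sig1 i)).
  have Fi theta : theta \in Th i ->
      F [set n | near_lattice 1 8^-1 (theta * n%:R ^+ (d (tagnat.sig1 i) - tagnat.sig2 i))].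
    move=> thi; apply: Fmon => //.
    by apply/flattenP; exists (Th i) => //; apply/mapP; exists i; rewrite ?mem_enum.
  apply: (filterS _ (filter_forall_mem FF Fi)) => n nP /=.
  rewrite /phases !mxE; apply: ThP => theta thi.
  by rewrite natrX; exact: nP.
have Fall := @filterI _ F FF _ _ Fpos
  (filter_forall_mem (s := enum 'I_(\sum_j d j)) FF (fun i _ => Fentry i)).
have [n [n0 nP] Un] := Fvis u v U _ uHC Uv Fall.
exists (iter n T u, phases g d n); split; first by exists n.
apply: UWB; split => //=; apply: PW => i j.
by rewrite (ord1 i); apply: nP; rewrite mem_enum.
Qed.
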